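(* Let $\lambda\in\mathbb{C}$. For any function $g(x)=f(x^{-1})$, with $f(x)$ a polynomial of degree $n$, and a non-zero real number $a$, we have the following $\lambda$-Taylor expansion: $$f(x^{-1})=\sum_{k=0}^{n}c_k\,(x-a)_\lambda^k,$$ where $$c_0=g(a),\qquad c_1=\frac{\lambda(\widehat{\mathrm{I}}_\lambda g)(a)-a\,g(a)}{a(1-\lambda)},\qquad\ldots,\qquad c_n=\frac{\lambda^{\binom{n+1}{2}}(\widehat{\mathrm{I}}_\lambda^{n}g)(a)}{a^n(\lambda;\lambda)_n}-\sum_{i=1}^{n-1}\frac{c_i}{(\lambda;\lambda)_{n-i}},$$ the coefficients $c_m$ with $2\le m<n$ being given by the last formula with $m$ in place of $n$.
   Context: $(x-a)_\lambda^0=1$ and $(x-a)_\lambda^k=\prod_{j=0}^{k-1}\left(1-\frac{a}{\lambda^j x}\right)$ for $k\ge 1$ (this is a function of $x$ and $a$, not an ordinary power). $(\lambda;\lambda)_0=1$ and $(\lambda;\lambda)_m=\prod_{j=1}^{m}(1-\lambda^j)$ for $m\ge1$. The $\lambda$-integral operator is $(\widehat{\mathrm{I}}_\lambda g)(x)=\frac{x}{\lambda}g\left(\frac{x}{\lambda}\right)$, provided that $g(x/\lambda)$ exists, and $\widehat{\mathrm{I}}_\lambda^m$ is its $m$-fold iterate.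
   Formalization: The sum in the formula for c_m (2 ≤ m ≤ n) starts at i=0 instead of the printed i=1, which is false (λ=2, a=1, f=X^2); λ≠0 and λ^j≠1 for 1≤j≤n are assumed so that the formulas are defined. *)

(* Defs.v *)
From HB Require Import structures.
From mathcomp Require Import all_boot all_order all_algebra.
From mathcomp Require Import complex reals.

Set Implicit Arguments.
Unset Strict Implicit.
Unset Printing Implicit Defensive.

Import GRing.Theory.
Local Open Scope ring_scope.

(* The deformed power (x - a)_lam^k: a function of the pair (x, a), not of the
   difference x - a. *)
Definition lampow (F : fieldType) (lam x a : F) (k : nat) : F :=
  \prod_(j < k) (1 - a / (lam ^+ j * x)).

(* The q-Pochhammer symbol (lam; lam)_m. *)
Definition lampoch (F : fieldType) (lam : F) (m : nat) : F :=
  \prod_(1 <= j < m.+1) (1 - lam ^+ j).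

(* Meaningful only for lam != 0, where x / lam is a genuine quotient. *)
Definition lamint (F : fieldType) (lam : F) (g : F -> F) : F -> F :=
  fun x => x / lam * g (x / lam).

(* Main.v *)
(* In the variable [y = x^-1] the deformed powers are polynomials of degree
   exactly [k], so they form a basis and an expansion of [f] exists.  The
   coefficients are then forced: at the node [x = a / lam ^+ m] the powers with
   [k > m] vanish, the others are quotients of q-Pochhammer symbols, and
   [iter m (lamint lam) g a] is [g (a / lam ^+ m)] up to an explicit factor. *)
Require Import Defs.
From HB Require Import structures.
From mathcomp Require Import all_boot all_order all_algebra.
From mathcomp Require Import complex reals.
From mathcomp Require Import ring.

Import GRing.Theory.
Local Open Scope ring_scope.
Local Open Scope complex_scope.

(** Subtracting the multiple of the top [P n] that cancels the coefficient of index [n] lowers the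
    size; induction handles the rest. *)
Lemma graded_poly_span (F : fieldType) (P : nat -> {poly F}) (n : nat)
    (f : {poly F}) :
  (forall k, (k < n)%N -> size (P k) = k.+1) -> (size f <= n)%N ->
  exists c : nat -> F, f = \sum_(0 <= k < n) c k *: P k.
Proof.
elim: n f => [|n IHn] f sizeP.
  by rewrite leqn0 size_poly_eq0 => /eqP->; exists (fun=> 0); rewrite big_geq.
move=> size_f; pose b := f`_n / lead_coef (P n).
have lP0 : lead_coef (P n) != 0 by rewrite lead_coef_eq0 -size_poly_gt0 sizeP.
have size_g : (size (f - b *: P n)%R <= n)%N.
  apply/leq_sizeP => j; rewrite leq_eqVlt => /predU1P[<-|lt_nj].
    rewrite coefB coefZ /b lead_coefE sizeP //= divfK ?subrr //.
    by rewrite lead_coefE sizeP in lP0.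
  by rewrite coefB coefZ !nth_default ?mulr0 ?subr0 ?sizeP ?(leq_trans size_f).
have [c def_g] := IHn (f - b *: P n) (fun k lt_kn => sizeP k (ltnW lt_kn)) size_g.
exists (fun k => if k == n then b else c k).
rewrite big_nat_recr //= eqxx -[LHS](subrK (b *: P n)) def_g; congr (_ + _).
by apply: eq_big_nat => k /andP[_ lt_kn]; rewrite ltn_eqF.
Qed.

Section LamTaylor.

Variables (F : fieldType) (lam a : F).

Definition lampow_poly (k : nat) : {poly F} :=
  \prod_(j < k) (1 - (a / lam ^+ j) *: 'X).

(** No condition on [x]: at [x = 0] the convention [0^-1 = 0] makes every factor 1 on both sides. *)
Lemma horner_lampow_poly (k : nat) (x : F) :
  (lampow_poly k).[x^-1] = lampow lam x a k.
Proof.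
rewrite /lampow_poly horner_prod; apply: eq_bigr => j _.
by rewrite !hornerE invfM mulrA.
Qed.

(** The factor [j = 0] involves [lam ^+ 0 = 1], so [lam] may vanish as long as [k <= 1]. *)
Lemma size_lampow_poly (k : nat) :
  a != 0 -> ((1 < k)%N -> lam != 0) -> size (lampow_poly k) = k.+1.
Proof.
move=> a0 lam0; rewrite /lampow_poly.
have size_fac (j : 'I_k) : size (1 - (a / lam ^+ j) *: 'X : {poly F}) = 2%N.
  have b0 : a / lam ^+ j != 0.
    rewrite mulf_neq0 // invr_eq0; case: j => -[|j] /= lt_jk.
      by rewrite expr0 oner_neq0.
    by rewrite expf_neq0 // lam0 // (leq_ltn_trans _ lt_jk).
  by rewrite addrC size_polyDl size_polyN size_scale // size_polyX ?size_poly1.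
rewrite size_prod => [|j _]; last by rewrite -size_poly_gt0 size_fac.
under eq_bigr do rewrite size_fac.
by rewrite sum_nat_const !card_ord muln2 -addnn -addSn addnK.
Qed.

(** The iterations contribute the factors [x / lam ^+ i] for [i = 1, ..., m], and these exponents
    add up to ['C(m.+1, 2)]. *)
Lemma iter_lamint (g : F -> F) (m : nat) (x : F) : lam != 0 ->
  lam ^+ 'C(m.+1, 2) * iter m (lamint lam) g x = x ^+ m * g (x / lam ^+ m).
Proof.
move=> lam0; elim: m x => [|m IHm] x.
  by rewrite bin_small // expr0 !mul1r divr1.
rewrite iterS {1}/lamint binS bin1 exprD.
have -> (u v w z : F) : u * v * (w * z) = v * w * (u * z) by ring.
rewrite IHm mulrA; congr (_ * g _); last by rewrite -mulrA -invfM exprS.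
rewrite expr_div_n !exprS; field; by rewrite lam0 expf_neq0.
Qed.

Lemma lampoch_neq0 (n m : nat) :
  (forall j : nat, (1 <= j <= n)%N -> lam ^+ j != 1) ->
  (m <= n)%N -> lampoch lam m != 0.
Proof.
move=> lam1 le_mn; rewrite /lampoch big_nat prodf_seq_neq0.
apply/allP => j _; apply/implyP => /andP[j1 jm].
by rewrite subr_eq0 eq_sym lam1 // j1 (leq_trans _ le_mn).
Qed.

(** At this node the factor of index [j] is [1 - lam ^+ (m - j)], so the deformed power consists of
    the top [k] factors of [lampoch lam m]. Assuming [lam ^+ m != 0] keeps the case [m = 0],
    [lam = 0]. *)
Lemma lampow_node (m k : nat) : a != 0 -> lam ^+ m != 0 -> (k <= m)%N ->
  lampow lam (a / lam ^+ m) a k * lampoch lam (m - k) = lampoch lam m.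
Proof.
move=> a0 lamm0; elim: k => [|k IHk] lt_km.
  by rewrite /lampow big_ord0 mul1r subn0.
have lam0 : lam != 0 by move: lamm0; rewrite expf_eq0 (leq_ltn_trans _ lt_km).
rewrite -(IHk (ltnW lt_km)) /lampow big_ord_recr /= -mulrA; congr (_ * _).
rewrite -[in RHS](subnSK lt_km) /lampoch [RHS]big_nat_recr //= mulrC.
congr (_ * (1 - _)); rewrite (subnSK lt_km).
rewrite -[in LHS](subnK (ltnW lt_km)) exprD.
have := expf_neq0 (m - k) lam0; have := expf_neq0 k lam0.
move: (lam ^+ k) (lam ^+ (m - k)) => u v u0 v0.
by field; rewrite a0 u0 v0.
Qed.

Lemma lampow_node_eq0 (m k : nat) : a != 0 -> lam ^+ m != 0 -> (m < k)%N ->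
  lampow lam (a / lam ^+ m) a k = 0.
Proof.
(* The factor of index [j = m] is [1 - 1]. *)
move=> a0 lamm0 lt_mk; rewrite /lampow (bigD1 (Ordinal lt_mk)) //=.
by rewrite mulrCA divff // mulr1 divff // subrr mul0r.
Qed.

Lemma lampow_coef_rec (n m : nat) (y : F) (c : nat -> F) :
  a != 0 -> lam ^+ m != 0 ->
  (forall j : nat, (1 <= j <= n)%N -> lam ^+ j != 1) -> (m <= n)%N ->
  y = \sum_(0 <= k < n.+1) c k * lampow lam (a / lam ^+ m) a k ->
  c m = y / lampoch lam m - \sum_(0 <= i < m) c i / lampoch lam (m - i).
Proof.
move=> a0 lamm0 lam1 le_mn ->.
have poch0 := lampoch_neq0 n _ lam1.
have tail0 : \sum_(m.+1 <= k < n.+1) c k * lampow lam (a / lam ^+ m) a k = 0.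
  rewrite big_nat big1 // => k /andP[lt_mk _].
  by rewrite lampow_node_eq0 ?mulr0.
rewrite (@big_cat_nat _ _ _ m.+1) //= tail0 addr0.
have -> : \sum_(0 <= k < m.+1) c k * lampow lam (a / lam ^+ m) a k =
    (\sum_(0 <= k < m.+1) c k / lampoch lam (m - k)) * lampoch lam m.
  rewrite mulr_suml; apply: eq_big_nat => k /andP[_ le_km].
  rewrite -(lampow_node m k) // mulrAC -mulrA mulfK ?poch0 //.
  by rewrite (leq_trans (leq_subr _ _)).
(* The term [k = m] has denominator [lampoch lam 0 = 1], which isolates [c m]. *)
rewrite mulfK ?poch0 // big_nat_recr //= subnn.
by rewrite /lampoch [X in _ / X]big_geq // divr1 addrAC subrr add0r.
Qed.

End LamTaylor.

(* The sum in c m runs from i = 0: the formula for c 1 is the case m = 1 of this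
   recurrence, and without the i = 0 term the expansion already fails for
   lam = 2, a = 1, f = 'X^2. *)
Theorem theorem4 (R : realType) (lam : R[i]) (n : nat) (f : {poly R[i]})
    (a : R)
    (lam_neq0 : (0 < n)%N -> lam != 0)
    (lam_pow_neq1 : forall j : nat, (1 <= j <= n)%N -> lam ^+ j != 1)
    (deg_f : size f = n.+1)
    (a_neq0 : a != 0) :
  let g : R[i] -> R[i] := fun x => f.[x^-1] in
  exists c : nat -> R[i],
    [/\ c 0%N = g a%:C,
        (1 <= n)%N ->
          c 1%N = (lam * lamint lam g a%:C - a%:C * g a%:C)
                  / (a%:C * (1 - lam)),
        forall m : nat, (2 <= m <= n)%N ->
          c m = lam ^+ 'C(m.+1, 2) * iter m (lamint lam) g a%:C
                  / (a%:C ^+ m * lampoch lam m)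
                - \sum_(0 <= i < m) c i / lampoch lam (m - i)
      & forall x : R[i], x != 0 ->
          f.[x^-1] = \sum_(0 <= k < n.+1) c k * lampow lam x a%:C k].
Proof.
set A := a%:C => g.
have A0 : A != 0 by rewrite fmorph_eq0.
have lamX0 m : (m <= n)%N -> lam ^+ m != 0.
  case: m => [|m] le_mn; first exact: oner_neq0.
  by rewrite expf_neq0 // lam_neq0 // (leq_trans _ le_mn).
have [|c def_f] :=
    graded_poly_span _ (lampow_poly _ lam A) n.+1 f _ (eq_leq deg_f).
  move=> k lt_kn; apply: size_lampow_poly => // k1.
  by rewrite lam_neq0 // -ltnS (ltn_trans k1).
have expand x : g x = \sum_(0 <= k < n.+1) c k * lampow lam x A k.
  rewrite /g def_f horner_sum; apply: eq_bigr => k _.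
  by rewrite hornerZ horner_lampow_poly.
(* The hole is filled with [y = g (A / lam ^+ m)]; all three coefficient formulas are read off from
   it. *)
have rec m (le_mn : (m <= n)%N) : c m = _ :=
  lampow_coef_rec _ _ _ n m _ _ A0 (lamX0 m le_mn) lam_pow_neq1 le_mn (expand _).
have c0 : c 0%N = g A by rewrite rec // /lampoch !big_geq // subr0 !divr1.
exists c; split=> [//|n1|m /andP[m2 le_mn]|x _]; last exact: expand.
  have lam0 := lam_neq0 n1.
  have := lam_pow_neq1 1%N; rewrite n1 expr1 eq_sym -subr_eq0 => /(_ isT) lam1.
  rewrite rec // big_nat1 c0 /lampoch big_nat1 !expr1 /lamint.
  by field; rewrite lam0 lam1 A0.
have lam0 : lam != 0 by rewrite lam_neq0 // (leq_trans _ le_mn) // ltnW.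
(* The numerator becomes [A ^+ m * g (A / lam ^+ m)], and [A ^+ m] cancels. *)
rewrite [LHS]rec // iter_lamint //; congr (_ - _).
by rewrite -mulf_div divff ?mul1r ?expf_neq0.
Qed.
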